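(* For every doubly distributive skew hyperfield $F$ there exist a linearly ordered group $(G,<)$ and a valuation $\nu : F \to G\cup\{-\infty\}$ such that $\nu^{-1}(1_G)\cup\{0\}$, equipped with the multiplication of $F$ and the hyperaddition $(x,y)\mapsto (x\boxplus y)\cap(\nu^{-1}(1_G)\cup\{0\})$, is (isomorphic to) the Krasner hyperfield, or the sign hyperfield, or a skew field.
   Context: A hyperoperation on a set $S$ is a map $\boxplus$ from $S\times S$ to the nonempty subsets of $S$; for nonempty $A,B\subseteq S$ put $A\boxplus B=\bigcup_{a\in A,b\in B}a\boxplus b$; $\boxplus$ is associative if $a\boxplus(b\boxplus c)=(a\boxplus b)\boxplus c$ for all $a,b,c$. A hypergroup is $(G,\boxplus,0)$ with $\boxplus$ an associative hyperoperation such that: $0\boxplus x=x\boxplus 0=\{x\}$ for all $x$; for every $x$ there is a unique $x'$ with $0\in x\boxplus x'$ and a unique $x''$ with $0\in x''\boxplus x$, and $x'=x''$, denoted $-x$; and $x\in y\boxplus z$ if and only if $-x\in -z\boxplus -y$. It is commutative if $y\boxplus z=z\boxplus y$ for all $y,z$. A skew hyperring is $(R,\odot,\boxplus,1,0)$ with $(R,\odot,1)$ a monoid, $(R,\boxplus,0)$ a commutative hypergroup, $x\odot 0=0\odot x=0$, and $a\odot(x\boxplus y)=(a\odot x)\boxplus(a\odot y)$, $(x\boxplus y)\odot a=(x\odot a)\boxplus(y\odot a)$. A skew hyperfield is a skew hyperring with $0\ne1$ in which every nonzero element has a multiplicative inverse. It is doubly distributive if $(a\boxplus b)(c\boxplus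 d)=ac\boxplus ad\boxplus bc\boxplus bd$ for all $a,b,c,d$ (products of sets being taken elementwise). A skew field is regarded as a skew hyperfield with $a\boxplus b=\{a+b\}$. The Krasner hyperfield is $\mathbb{K}=\{0,1\}$ with usual multiplication, $0\boxplus x=x\boxplus 0=\{x\}$ and $1\boxplus1=\{0,1\}$. The sign hyperfield is $\mathbb{S}=\{0,1,-1\}$ with usual multiplication, $0\boxplus x=x\boxplus 0=\{x\}$, $x\boxplus x=\{x\}$, $1\boxplus-1=-1\boxplus 1=\{0,1,-1\}$. Isomorphisms are bijections preserving $0$, $1$, multiplication and hyperaddition. A valuation of a skew hyperfield $F$ is a map $\nu:F\to G\cup\{-\infty\}$, where $(G,<)$ is a linearly ordered group (order invariant under left and right multiplication) and $-\infty$ is smaller than every element of $G$ and absorbing for multiplication, such that: (1) $\nu(x)=-\infty$ iff $x=0$; (2) $\nu(xy)=\nu(x)\cdot\nu(y)$; (3) $\nu(x)>\nu(y)$ implies $x\boxplus y=\{x\}$. $1_G$ is the identity of $G$. *)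

(* Defs.v *)
From HB Require Import structures.
From mathcomp Require Import all_boot all_order all_algebra.
From mathcomp Require Import boolp classical_sets.

Set Implicit Arguments.
Unset Strict Implicit.
Unset Printing Implicit Defensive.

Local Open Scope classical_set_scope.

Section Hyperoperations.
Variables (T : Type) (add : T -> T -> set T).

Definition set_hadd (A B : set T) : set T :=
  \bigcup_(a in A) \bigcup_(b in B) add a b.

Definition is_hyperop := forall x y, add x y !=set0.

Definition hassociative := forall a b c,
  set_hadd [set a] (add b c) = set_hadd (add a b) [set c].

Definition is_hypergroup (zero : T) :=
  is_hyperop /\ hassociative /\
  (forall x, add zero x = [set x] /\ add x zero = [set x]) /\
  exists opp : T -> T,
    [/\ forall x, unique (fun x' => add x x' zero) (opp x),
        forall x, unique (fun x' => add x' x zero) (opp x) &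
        forall x y z, add y z x <-> add (opp z) (opp y) (opp x)].

Definition is_comm_hypergroup (zero : T) :=
  is_hypergroup zero /\ forall y z, add y z = add z y.

End Hyperoperations.

(* The bare operations, without axioms: isomorphisms make sense at this level,
   so no axiom has to be established beforehand for the residue structure of a
   valuation. *)
Record hyperstruct := Hyperstruct {
  hcarrier :> Type;
  hzero : hcarrier;
  hone : hcarrier;
  hmul : hcarrier -> hcarrier -> hcarrier;
  hadd : hcarrier -> hcarrier -> set hcarrier
}.

Arguments hzero {h}.
Arguments hone {h}.
Arguments hmul {h}.
Arguments hadd {h}.

Definition set_hmul (R : hyperstruct) (A B : set R) : set R :=
  [set hmul a b | a in A & b in B].

Definition is_skew_hyperring (R : hyperstruct) :=
  (associative (@hmul R) /\ left_id hone (@hmul R) /\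
   right_id hone (@hmul R)) /\
  is_comm_hypergroup (@hadd R) hzero /\
  (forall x : R, hmul x hzero = hzero /\ hmul hzero x = hzero) /\
  (forall a x y : R,
     set_hmul [set a] (hadd x y) = hadd (hmul a x) (hmul a y)) /\
  (forall a x y : R,
     set_hmul (hadd x y) [set a] = hadd (hmul x a) (hmul y a)).

Definition is_skew_hyperfield (F : hyperstruct) :=
  is_skew_hyperring F /\ (hzero : F) <> hone /\
  forall x : F, x <> hzero -> exists y : F, hmul x y = hone /\ hmul y x = hone.

Record skewHyperfield := SkewHyperfield {
  skf_struct :> hyperstruct;
  skfP : is_skew_hyperfield skf_struct
}.

Definition doubly_distributive (F : hyperstruct) := forall a b c d : F,
  set_hmul (hadd a b) (hadd c d) =
  set_hadd hadd
    (set_hadd hadd (hadd (hmul a c) (hmul a d)) [set hmul b c])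
    [set hmul b d].

Definition hisomorphic (R S : hyperstruct) := exists f : R -> S,
  [/\ bijective f, f hzero = hzero, f hone = hone,
      forall x y, f (hmul x y) = hmul (f x) (f y) &
      forall x y, f @` hadd x y = hadd (f x) (f y)].

Definition krasner_hadd (x y : bool) : set bool :=
  match x, y with
  | false, _ => [set y]
  | _, false => [set x]
  | true, true => [set: bool]
  end.

Definition krasner : hyperstruct := Hyperstruct false true andb krasner_hadd.

Inductive sign := SZero | SOne | SMinusOne.

Definition sign_mul (x y : sign) : sign :=
  match x, y with
  | SZero, _ | _, SZero => SZero
  | SOne, _ => y
  | _, SOne => x
  | SMinusOne, SMinusOne => SOne
  end.

Definition sign_hadd (x y : sign) : set sign :=
  match x, y with
  | SZero, _ => [set y]
  | _, SZero => [set x]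
  | SOne, SOne => [set SOne]
  | SMinusOne, SMinusOne => [set SMinusOne]
  | SOne, SMinusOne | SMinusOne, SOne => [set: sign]
  end.

Definition sign_hyperfield : hyperstruct :=
  Hyperstruct SZero SOne sign_mul sign_hadd.

Section Rings.
Local Open Scope ring_scope.

Definition is_skew_field (K : unitRingType) :=
  forall x : K, x != 0 -> x \is a GRing.unit.

Definition hyperstruct_of_ring (K : nzRingType) : hyperstruct :=
  Hyperstruct (0 : K) 1 *%R (fun a b => [set a + b]).

End Rings.

HB.mixin Record Group_isOrdered d G of Group G & Order.Total d G := {
  ltgM2l : forall z x y : G, (x < y)%O -> (z * x < z * y)%O%g;
  ltgM2r : forall z x y : G, (x < y)%O -> (x * z < y * z)%O%g
}.

#[short(type="orderedGroupType")]
HB.structure Definition OrderedGroup d :=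
  { G of Group_isOrdered d G & Group G & Order.Total d G }.

Section Valuations.
Variables (d : Order.disp_t) (G : orderedGroupType d).

(* [option G] is G with a bottom element adjoined, [None] being -oo. *)
Definition ninfty_mul (u v : option G) : option G :=
  match u, v with Some a, Some b => Some (a * b)%g | _, _ => None end.

Definition ninfty_lt (u v : option G) : bool :=
  match u, v with
  | Some a, Some b => (a < b)%O
  | None, Some _ => true
  | _, None => false
  end.

Definition is_valuation (F : skewHyperfield) (nu : F -> option G) :=
  [/\ forall x, nu x = None <-> x = hzero,
      forall x y, nu (hmul x y) = ninfty_mul (nu x) (nu y) &
      forall x y, ninfty_lt (nu y) (nu x) -> hadd x y = [set x]].

Record valuation (F : skewHyperfield) := Valuation {
  val_fun :> F -> option G;
  valuationP : is_valuation val_fun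
}.

Section Residue.
Variables (F : skewHyperfield) (nu : valuation F).

Definition residue_set : set F :=
  (nu @^-1` [set Some 1%g]) `|` [set hzero].

Lemma residue_zero : residue_set hzero.
Proof. by right. Qed.

Lemma valuation1 : nu hone = Some 1%g.
Proof.
have [nu0 nuM _] := valuationP nu.
have [[[_ [mul1 _]] _] [n01 _]] := skfP F.
have := nuM hone hone; rewrite mul1; case E: (nu hone) => [a|] /=.
  by case=> /esym/(congr1 (fun b => a^-1 * b)%g) /=; rewrite mulKg mulVg => ->.
by move/nu0: E => /esym.
Qed.

Lemma residue_one : residue_set hone.
Proof. by left; exact: valuation1. Qed.

Lemma residue_mul (x y : F) :
  residue_set x -> residue_set y -> residue_set (hmul x y).
Proof.
have [_ nuM _] := valuationP nu; have [[_ [_ [mul0 _]]] _] := skfP F.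
move=> [/= nux|->]; last by rewrite (mul0 y).2; right.
move=> [/= nuy|->]; last by rewrite (mul0 x).1; right.
by left; rewrite /= nuM nux nuy /= mulg1.
Qed.

Definition residue_hyperstruct : hyperstruct :=
  @Hyperstruct {x : F | residue_set x}
    (exist _ hzero residue_zero)
    (exist _ hone residue_one)
    (fun x y => exist _ (hmul (sval x) (sval y))
                        (residue_mul (svalP x) (svalP y)))
    (fun x y => [set z | hadd (sval x) (sval y) (sval z)]).

End Residue.
End Valuations.

(* Main.v *)
(* In a doubly distributive skew hyperfield, [x [+] y] is a singleton unless
   [y = -x]. Say that [a] is dominated by [b <> 0] when [a] lies in [b [+] -b]
   but is neither [b] nor [-b]; equivalently [b [+] a = {b}] and [a <> b, -b].
   Singleton-valuedness makes this a strict weak order, invariant under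
   multiplication by nonzero elements on both sides, so its incomparability
   classes form an ordered group and the class map is a valuation. Let [U] be
   the class of 1. If 1 lies in [1 [+] -1], then [U = {1, -1}] and the residue
   is the Krasner or the sign hyperfield according to whether [-1 = 1].
   Otherwise [x [+] -x] meets [U] together with 0 only in 0, so addition on the
   residue is single-valued. *)
Require Import Defs.
From HB Require Import structures.
From mathcomp Require Import all_boot all_order all_algebra.
From mathcomp Require Import boolp classical_sets.

Set Implicit Arguments.
Unset Strict Implicit.
Unset Printing Implicit Defensive.

Local Open Scope classical_set_scope.

Declare Scope hyper_scope.
Local Notation "x * y" := (hmul x y) : hyper_scope.
Local Notation "x [+] y" := (hadd x y)
  (at level 50, left associativity) : hyper_scope.
Local Notation "\0" := hzero : hyper_scope.
Local Notation "\1" := hone : hyper_scope.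
Local Open Scope hyper_scope.

(** * Skew hyperfields and the dominance order *)

Section SkewHyperfieldTheory.
Variable F : skewHyperfield.
Implicit Types a b c x y z u v t : F.

Lemma hmulA : associative (@hmul F).
Proof. by have [[[]]] := skfP F. Qed.

Lemma hmul1x : left_id \1 (@hmul F).
Proof. by have [[[? []]]] := skfP F. Qed.

Lemma hmulx1 : right_id \1 (@hmul F).
Proof. by have [[[? []]]] := skfP F. Qed.

Lemma hmul0x x : \0 * x = \0.
Proof. by have [[_ [_ [/(_ x)[]]]]] := skfP F. Qed.

Lemma hmulx0 x : x * \0 = \0.
Proof. by have [[_ [_ [/(_ x)[]]]]] := skfP F. Qed.

Lemma hone_neq0 : \1 <> \0 :> F.
Proof. by have [_ [/[swap] _ n] /esym] := skfP F. Qed.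

Lemma haddC x y : x [+] y = y [+] x.
Proof. by have [[_ [[_ ?] _]] _] := skfP F. Qed.

Lemma hadd_nonempty x y : x [+] y !=set0.
Proof. by have [[_ [[[? _] _] _]] _] := skfP F. Qed.

Lemma hadd0x x : \0 [+] x = [set x].
Proof. by have [[_ [[[_ [_ [/(_ x)[]]]]]]]] := skfP F. Qed.

Lemma haddx0 x : x [+] \0 = [set x].
Proof. by rewrite haddC hadd0x. Qed.

Lemma haddA x y z u t :
  (x [+] y) u -> (u [+] z) t -> exists2 w, (y [+] z) w & (x [+] w) t.
Proof.
have [[_ [[[_ [/(_ x y z) E _]] _] _]] _] := skfP F.
move=> xyu uzt.
have : set_hadd hadd (x [+] y) [set z] t by exists u => //; exists z.
by rewrite -E => -[_ -> [w ? ?]]; exists w.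
Qed.

Lemma haddA' x y z w t :
  (y [+] z) w -> (x [+] w) t -> exists2 u, (x [+] y) u & (u [+] z) t.
Proof.
rewrite haddC (haddC x) => zyw wxt; have [u] := haddA zyw wxt.
by rewrite haddC (haddC z) => *; exists u.
Qed.

Lemma hopp_subproof : exists opp : F -> F,
  (forall x y, (x [+] y) \0 <-> y = opp x).
Proof.
have [[_ [[[_ [_ [_ [opp [Hopp _ _]]]]] _] _]] _] := skfP F.
by exists opp => x y; have [Hx uniq] := Hopp x; split=> [/uniq|->].
Qed.

(** The axioms only assert that a negation exists. Choice extracts one, and [hadd_eq0] characterises
    it because opposites are unique. *)
Definition hopp : F -> F := projT1 (cid hopp_subproof).

Lemma hadd_eq0 x y : (x [+] y) \0 <-> y = hopp x.
Proof. exact: (projT2 (cid hopp_subproof)). Qed.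

Lemma hoppK : involutive hopp.
Proof. by move=> x; apply/esym/hadd_eq0; rewrite haddC; apply/hadd_eq0. Qed.

Lemma hopp_inj : injective hopp.
Proof. exact: inv_inj hoppK. Qed.

Lemma hopp0 : hopp \0 = \0.
Proof. by apply/esym/hadd_eq0; rewrite hadd0x. Qed.

Lemma hopp_eq0 x : hopp x = \0 -> x = \0.
Proof. by rewrite -{1}hopp0 => /hopp_inj. Qed.

(** Since 0 lies in -x + x and x in y + z, reassociating gives u in -x + y with z = -u. The reversal
    axiom then puts -u in -y + x. *)
Lemma hadd_rev x y z : (y [+] z) x -> (x [+] hopp y) z.
Proof.
move=> yzx.
have : (hopp x [+] x) \0 by rewrite haddC; apply/hadd_eq0.
move=> /(haddA' yzx)[u xyu /hadd_eq0 zE].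
have [[_ [[[_ [_ [_ [opp [Hopp _ rev]]]]] _] _]] _] := skfP F.
have oppE w : opp w = hopp w by apply/hadd_eq0; have [] := Hopp w.
by move: xyu; rewrite rev !oppE hoppK -zE haddC.
Qed.

Lemma hmulDl a x y z : (x [+] y) z -> (a * x [+] a * y) (a * z).
Proof.
have [[_ [_ [_ [/(_ a x y) <- _]]]] _] := skfP F.
by move=> xyz; exists a => //; exists z.
Qed.

Lemma hmulDr a x y z : (x [+] y) z -> (x * a [+] y * a) (z * a).
Proof.
have [[_ [_ [_ [_ /(_ a x y) <-]]]] _] := skfP F.
by move=> xyz; exists z => //; exists a.
Qed.

Lemma hmulNx x y : hopp x * y = hopp (x * y).
Proof.
apply/hadd_eq0; have /hadd_eq0/(hmulDr y) := erefl (hopp x).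
by rewrite hmul0x.
Qed.

Lemma hmulxN x y : x * hopp y = hopp (x * y).
Proof.
apply/hadd_eq0; have /hadd_eq0/(hmulDl x) := erefl (hopp y).
by rewrite hmulx0.
Qed.

Lemma haddN x y z : (x [+] y) z -> (hopp x [+] hopp y) (hopp z).
Proof. by move=> /(hmulDl (hopp \1)); rewrite !hmulNx !hmul1x. Qed.

Lemma hinv_subproof : exists inv : F -> F,
  forall x, x <> \0 -> x * inv x = \1 /\ inv x * x = \1.
Proof.
have [_ [_ invF]] := skfP F.
have /choice[inv ?] : forall x : F, exists y,
    x <> \0 -> x * y = \1 /\ y * x = \1.
  by move=> x; have [->|/invF[y]] := EM (x = \0); [exists \0 | exists y].
by exists inv.
Qed.

Definition hinv : F -> F := projT1 (cid hinv_subproof).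

Lemma hmulxV x : x <> \0 -> x * hinv x = \1.
Proof. by move=> /(projT2 (cid hinv_subproof))[]. Qed.

Lemma hmulVx x : x <> \0 -> hinv x * x = \1.
Proof. by move=> /(projT2 (cid hinv_subproof))[]. Qed.

Lemma hmulI a : a <> \0 -> injective (hmul a).
Proof.
by move=> a0 x y /(congr1 (hmul (hinv a))); rewrite !hmulA hmulVx// !hmul1x.
Qed.

Lemma hmulIr a : a <> \0 -> injective (fun x => x * a).
Proof.
move=> a0 x y /(congr1 (hmul^~ (hinv a))) /=.
by rewrite -!hmulA hmulxV// !hmulx1.
Qed.

Lemma hmul_neq0 x y : x <> \0 -> y <> \0 -> x * y <> \0.
Proof. by move=> x0 y0; rewrite -(hmulx0 x) => /(hmulI x0). Qed.

Lemma hinv_neq0 x : x <> \0 -> hinv x <> \0.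
Proof. by move=> /hmulxV/[swap] ->; rewrite hmulx0 => /esym/hone_neq0. Qed.

(** This is all that the rest of the proof takes from double distributivity. *)
Definition stringent := forall a b u v,
  b <> hopp a -> (a [+] b) u -> (a [+] b) v -> u = v.

(* If [u <> v] both lie in [a [+] b], then with [x := u * hinv v <> 1] the
   elements [u] and [x * v] coincide, so 0 lies in [a [+] b [+] -xa [+] -xb],
   i.e. in the product of [1 [+] -x] and [a [+] b], neither of which
   contains 0. *)
Lemma doubly_distributive_stringent : doubly_distributive F -> stringent.
Proof.
move=> dd a b u v ba abu abv; have [//|uv] := EM (u = v).
have v0 : v <> \0 by move=> v0; apply/ba/hadd_eq0; rewrite -v0.
pose x := u * hinv v.
have xv : x * v = u by rewrite -hmulA hmulVx// hmulx1.
have x1 : x <> \1 by move=> x1; apply: uv; rewrite -xv x1 hmul1x.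
have abxu : (hopp x * a [+] hopp x * b) (hopp u).
  by rewrite -xv -hmulNx; apply: hmulDl.
have /hadd_eq0/(haddA' abxu)[w uw w0] := erefl (hopp u).
have : set_hmul (\1 [+] hopp x) (a [+] b) \0.
  rewrite dd; exists w; last by eexists.
  by exists u; [rewrite !hmul1x | eexists].
move=> [p px [q abq pq0]]; have p0 : p <> \0.
  by move=> p0; move: px; rewrite p0 => /hadd_eq0/hopp_inj.
have q0 : q <> \0 by move=> q0; apply/ba/hadd_eq0; rewrite -q0.
by case: (hmul_neq0 p0 q0).
Qed.

(** With membership in b + -b instead of absorption, invariance under negation and multiplication
    needs no stringency. *)
Definition dominated a b :=
  [/\ b <> \0, a <> b, a <> hopp b & (b [+] hopp b) a].

Lemma haddNC b : hopp b [+] hopp (hopp b) = b [+] hopp b.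
Proof. by rewrite hoppK haddC. Qed.

Lemma dominatedNx a b : dominated a b -> dominated (hopp a) b.
Proof.
move=> [b0 ab aNb ba]; split=> //; last by rewrite -haddNC; apply: haddN.
  by move/(congr1 hopp); rewrite hoppK.
by move/hopp_inj.
Qed.

Lemma dominatedxN a b : dominated a b -> dominated a (hopp b).
Proof.
by move=> [b0 ab aNb ba]; split; rewrite ?haddNC ?hoppK// => /hopp_eq0.
Qed.

Lemma dominatedMl c a b : c <> \0 -> dominated a b -> dominated (c * a) (c * b).
Proof.
move=> c0 [b0 ab aNb ba]; split; rewrite -?hmulxN; first exact: hmul_neq0.
- by move/(hmulI c0).
- by move/(hmulI c0).
- exact: hmulDl.
Qed.

Lemma dominatedMr c a b : c <> \0 -> dominated a b -> dominated (a * c) (b * c).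
Proof.
move=> c0 [b0 ab aNb ba]; split; rewrite -?hmulNx; first exact: hmul_neq0.
- by move/(hmulIr c0).
- by move/(hmulIr c0).
- exact: hmulDr.
Qed.

Lemma dominated0x b : b <> \0 -> dominated \0 b.
Proof.
move=> b0; split=> //; [exact/nesym|by move/esym/hopp_eq0|exact/hadd_eq0].
Qed.

Lemma dominated_irr a : ~ dominated a a.
Proof. by case. Qed.

Hypothesis strF : stringent.

Lemma hadd_set1 a b c : b <> hopp a -> (a [+] b) c -> a [+] b = [set c].
Proof.
move=> ba abc; apply/seteqP; split=> [x /(strF ba)/(_ abc)//|_ -> //].
Qed.

(** Reversibility turns a in b + -b into b in b + a, and a <> -b makes this sum a singleton. *)
Lemma dominated_hadd a b : dominated a b -> b [+] a = [set b].
Proof.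
move=> [b0 ab aNb ba]; apply: hadd_set1 => //.
by move: ba; rewrite haddC => /hadd_rev; rewrite hoppK haddC.
Qed.

Lemma hadd_dominated a b :
  b <> \0 -> a <> b -> a <> hopp b -> (b [+] a) b -> dominated a b.
Proof. by move=> b0 ab aNb /hadd_rev ba. Qed.

(** Otherwise the sum of [a] and [b] would be both {b} and {a}. *)
Lemma dominated_asym a b : dominated a b -> ~ dominated b a.
Proof.
move=> ab /dominated_hadd; rewrite haddC (dominated_hadd ab).
by move=> /seteqP[/(_ b erefl)/= /esym ba _]; case: ab.
Qed.

(* Otherwise [b [+] c = {d}] with [d <> b]; as [b [+] a = {b}], this set is also
   [b [+] e] where [a [+] c = {e}] with [e <> c], and then the singleton
   [d [+] -b] contains both [c] and [e]. *)
Lemma dominated_neg_trans a b c :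
  dominated a b -> dominated a c \/ dominated c b.
Proof.
move=> ab; have [b0 _ _ _] := ab.
have [c0|c0] := EM (c = \0); first by right; rewrite c0; exact: dominated0x.
have [->|cb] := EM (c = b); first by left.
have [->|cNb] := EM (c = hopp b); first by left; exact: dominatedxN.
have [->|ca] := EM (c = a); first by right.
have [->|cNa] := EM (c = hopp a); first by right; exact: dominatedNx.
have [bcb|bcNb] := EM ((b [+] c) b); first by right; exact: hadd_dominated.
have [cac|caNc] := EM ((c [+] a) c).
  left; apply: hadd_dominated => // [/esym//|aNc].
  by apply: cNa; rewrite aNc hoppK.
have [d bcd] := hadd_nonempty b c.
have bab : (b [+] a) b by rewrite dominated_hadd.
have [e ace bed] := haddA bab bcd.
case: caNc; suff {2}-> : c = e by rewrite haddC.
apply: (strF _ (hadd_rev bcd) (hadd_rev bed)).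
by move/hopp_inj => db; apply: bcNb; rewrite {2}db.
Qed.

End SkewHyperfieldTheory.

(** * The valuation of an invariant strict weak order *)

(** Transitivity is not a field: it follows from asymmetry and negative transitivity. By [wlt0x],
    zero is alone in its incomparability class, which becomes -oo. *)
Record weak_order (F : skewHyperfield) := WeakOrder {
  wlt : F -> F -> Prop;
  wlt_asym : forall x y, wlt x y -> ~ wlt y x;
  wlt_neg_trans : forall x y z, wlt x y -> wlt x z \/ wlt z y;
  wlt0x : forall x, x <> \0 -> wlt \0 x;
  wltMl : forall c x y, c <> \0 -> wlt x y -> wlt (c * x) (c * y);
  wltMr : forall c x y, c <> \0 -> wlt x y -> wlt (x * c) (y * c);
  wlt_hadd : forall x y, wlt x y -> y [+] x = [set y]
}.

Section ValuationOfWeakOrder.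
Variables (F : skewHyperfield) (W : weak_order F).
Notation lt := (wlt W).
Implicit Types x y z c : F.

Definition wsim x y := ~ lt x y /\ ~ lt y x.

Lemma wsim_refl x : wsim x x.
Proof. by split=> /[dup] /wlt_asym. Qed.

Lemma wsim_sym x y : wsim x y -> wsim y x.
Proof. by case. Qed.

Lemma wsim_trans y x z : wsim x y -> wsim y z -> wsim x z.
Proof. by move=> [xy yx] [yz zy]; split=> /(wlt_neg_trans y)[]. Qed.

Lemma wlt_wsim x x' y y' : wsim x x' -> wsim y y' -> lt x y -> lt x' y'.
Proof.
by move=> [xx' _] [_ y'y] /(wlt_neg_trans x')[|/(wlt_neg_trans y')[]].
Qed.

Lemma wsim0 x : wsim x \0 -> x = \0.
Proof. by move=> [_ x0]; apply: contrapT => /(wlt0x W). Qed.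

Lemma wsimMl c x y : c <> \0 -> wsim x y -> wsim (c * x) (c * y).
Proof.
move=> c0 [xy yx].
by split=> /(wltMl (hinv_neq0 c0)); rewrite !hmulA hmulVx// !hmul1x.
Qed.

Lemma wsimMr c x y : c <> \0 -> wsim x y -> wsim (x * c) (y * c).
Proof.
move=> c0 [xy yx].
by split=> /(wltMr (hinv_neq0 c0)); rewrite -!hmulA hmulxV// !hmulx1.
Qed.

(** Choosing a representative that depends only on the class ([eq_wrepr]) avoids a quotient type.
    The default [\1] is never reached, as [x] is similar to itself. *)
Definition wrepr x : F := @xget {classic F} \1 (wsim x).

Lemma wrepr_sim x : wsim (wrepr x) x.
Proof.
apply: wsim_sym; apply: (@xgetPex {classic F} \1 (wsim x)).
by exists x; apply: wsim_refl.
Qed.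

Lemma eq_wrepr x y : wsim x y -> wrepr x = wrepr y.
Proof.
move=> xy; congr (@xget {classic F}); apply/seteqP.
by split=> z; [exact/wsim_trans/wsim_sym|exact: wsim_trans].
Qed.

Lemma wrepr_neq0 x : x <> \0 -> wrepr x <> \0.
Proof.
by move=> x0 r0; apply/x0/wsim0/wsim_sym; rewrite -r0; apply: wrepr_sim.
Qed.

(** The quotient of the multiplicative group by [wsim], realised on the chosen representatives. *)
Definition value_group := {x : F | x <> \0 /\ wrepr x = x}.
Implicit Types f g h : value_group.

Definition value x (x0 : x <> \0) : value_group :=
  exist _ (wrepr x) (conj (wrepr_neq0 x0) (eq_wrepr (wrepr_sim x))).

Lemma value_eq g h : wsim (sval g) (sval h) -> g = h.
Proof.
move=> /eq_wrepr; rewrite (svalP g).2 (svalP h).2.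
by case: g h => x ? [y ?]; apply: eq_exist.
Qed.

Lemma value_neq0 g : sval g <> \0.
Proof. by case: g => x []. Qed.

Definition value_mul g h : value_group :=
  value (hmul_neq0 (@value_neq0 g) (@value_neq0 h)).

Definition value_one : value_group := value (@hone_neq0 F).

Definition value_inv g : value_group := value (hinv_neq0 (@value_neq0 g)).

Definition value_lt g h := `[< lt (sval g) (sval h) >].

(** Products of classes can be computed on arbitrary members, so the group laws descend from [F]. *)
Lemma value_mul_sim g h x y :
  wsim (sval g) x -> wsim (sval h) y -> wsim (sval (value_mul g h)) (x * y).
Proof.
move=> gx hy; apply: wsim_trans (wrepr_sim _) _.
have y0 : y <> \0 by move: hy => /[swap] -> /wsim0; exact: value_neq0.
exact: wsim_trans (wsimMl (@value_neq0 g) hy) (wsimMr y0 gx).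
Qed.

Lemma value_mulA : associative value_mul.
Proof.
move=> f g h; apply: value_eq.
have r k := wsim_refl (sval k).
apply: (@wsim_trans (sval f * (sval g * sval h))).
  by apply: value_mul_sim => //; apply: value_mul_sim.
rewrite hmulA; apply: wsim_sym.
by apply: value_mul_sim => //; apply: value_mul_sim.
Qed.

Lemma value_mul1 : left_id value_one value_mul.
Proof.
move=> g; apply: value_eq; rewrite -[X in wsim _ X]hmul1x.
by apply: value_mul_sim; [exact: wrepr_sim|exact: wsim_refl].
Qed.

Lemma value_mulx1 : right_id value_one value_mul.
Proof.
move=> g; apply: value_eq; rewrite -[X in wsim _ X]hmulx1.
by apply: value_mul_sim; [exact: wsim_refl|exact: wrepr_sim].
Qed.

Lemma value_mulVx : left_inverse value_one value_inv value_mul.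
Proof.
move=> g; apply: value_eq; apply/wsim_sym/(wsim_trans (wrepr_sim _)).
rewrite -(hmulVx (@value_neq0 g)); apply: wsim_sym.
by apply: value_mul_sim; [exact: wrepr_sim|exact: wsim_refl].
Qed.

Lemma value_mulxV : right_inverse value_one value_inv value_mul.
Proof.
move=> g; apply: value_eq; apply/wsim_sym/(wsim_trans (wrepr_sim _)).
rewrite -(hmulxV (@value_neq0 g)); apply: wsim_sym.
by apply: value_mul_sim; [exact: wsim_refl|exact: wrepr_sim].
Qed.

Lemma value_lt_irr : irreflexive value_lt.
Proof. by move=> g; apply/asboolP; case: (wsim_refl (sval g)). Qed.

Lemma value_lt_trans : transitive value_lt.
Proof.
move=> g f h /asboolP fg /asboolP gh; apply/asboolP.
by have [|/wlt_asym] := wlt_neg_trans (sval h) fg.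
Qed.

(** * The ordered group of classes and its valuation *)

HB.instance Definition _ := gen_eqMixin value_group.
HB.instance Definition _ := gen_choiceMixin value_group.

Lemma value_lt_total g h : g != h -> value_lt g h || value_lt h g.
Proof.
move=> /eqP gh; apply: contrapT => /negP; rewrite negb_or.
move=> /andP[/asboolPn ? /asboolPn ?].
by apply: gh; apply: value_eq.
Qed.

HB.instance Definition _ := isGroup.Build value_group
  value_mulA value_mul1 value_mulx1 value_mulVx value_mulxV.

HB.instance Definition _ :=
  Order.LtOrder.Build (Order.Disp tt tt) value_group
    (fun _ _ => erefl) (fun _ _ => erefl) (fun _ _ => erefl)
    value_lt_irr value_lt_trans value_lt_total.

Lemma value_ltM2l h f g : (f < g)%O -> (h * f < h * g)%O%g.
Proof.
move=> /asboolP fg; apply/asboolP.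
by apply: wlt_wsim (wltMl (@value_neq0 h) fg); apply/wsim_sym/wrepr_sim.
Qed.

Lemma value_ltM2r h f g : (f < g)%O -> (f * h < g * h)%O%g.
Proof.
move=> /asboolP fg; apply/asboolP.
by apply: wlt_wsim (wltMr (@value_neq0 h) fg); apply/wsim_sym/wrepr_sim.
Qed.

HB.instance Definition _ :=
  Group_isOrdered.Build (Order.Disp tt tt) value_group value_ltM2l value_ltM2r.

Definition wval x : option value_group :=
  if pselect (x <> \0) is left x0 then Some (value x0) else None.

Lemma wval0 : wval \0 = None.
Proof. by rewrite /wval; case: pselect. Qed.

Lemma wvalE x (x0 : x <> \0) : wval x = Some (value x0).
Proof.
rewrite /wval; case: pselect => // x0'; congr (Some (value _)).
exact: Prop_irrelevance.
Qed.

Lemma wval_is_valuation : is_valuation wval.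
Proof.
split=> [x|x y|x y].
- split=> [|->]; last exact: wval0.
  by have [//|x0] := EM (x = \0); rewrite (wvalE x0).
- have [->|x0] := EM (x = \0); first by rewrite hmul0x wval0.
  have [->|y0] := EM (y = \0).
    by rewrite hmulx0 wval0 (wvalE x0).
  rewrite (wvalE x0) (wvalE y0) (wvalE (hmul_neq0 x0 y0)) /=.
  congr Some; apply: value_eq; apply: wsim_trans (wrepr_sim _) _.
  by apply: wsim_sym; apply: value_mul_sim; exact: wrepr_sim.
- have [->|x0] := EM (x = \0); first by rewrite wval0; case: (wval y).
  have [->|y0] := EM (y = \0); first by rewrite haddx0.
  rewrite (wvalE x0) (wvalE y0) => /asboolP yx; apply: (@wlt_hadd _ W).
  by apply: wlt_wsim yx; exact: wrepr_sim.
Qed.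

Definition weak_order_valuation : valuation value_group F :=
  Valuation wval_is_valuation.

(** Reduces questions about the residue to similarity with [\1], without mention of the
    valuation. *)
Lemma residue_weak_order x : residue_set weak_order_valuation x <->
  x = \0 \/ wsim x \1.
Proof.
split=> [[] /=|[->|x1]]; last 2 first.
- by right.
- left; have x0 : x <> \0.
    by move=> x0; apply: (@hone_neq0 F); apply/wsim0/wsim_sym; rewrite -x0.
  rewrite /= (wvalE x0); congr Some; apply: value_eq.
  apply: wsim_trans (wrepr_sim _) _; apply: wsim_trans x1 _.
  exact/wsim_sym/wrepr_sim.
- have [->|x0] := EM (x = \0); first by left.
  rewrite (wvalE x0) => -[xE]; right.
  apply: wsim_trans (wsim_sym (wrepr_sim _)) _; rewrite xE; exact: wrepr_sim.
- by move->; left.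
Qed.

End ValuationOfWeakOrder.

(** * The residue *)

(** The isomorphism is given through its inverse because maps out of [krasner] and [sign_hyperfield]
    can be defined by cases. *)
Lemma hisomorphic_inv (R S : hyperstruct) (g : S -> R) :
  injective g -> (forall x, exists s, g s = x) ->
  g hzero = hzero -> g hone = hone -> {morph g : s t / s * t} ->
  (forall s t u, (g s [+] g t) (g u) <-> (s [+] t) u) ->
  hisomorphic R S.
Proof.
move=> g_inj /choice[f fK] g0 g1 gM gD.
have gK : cancel g f by move=> s; apply: g_inj; rewrite fK.
exists f; split.
- by exists g.
- by rewrite -g0 gK.
- by rewrite -g1 gK.
- by move=> x y; apply: g_inj; rewrite gM !fK.
- move=> x y; apply/seteqP; split=> [_ [z xyz <-]|s].
    by apply/gD; rewrite !fK.
  by move/gD; rewrite !fK => xys; exists (g s) => //; rewrite gK.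
Qed.

Lemma single_valued_skew_field (R : hyperstruct) (add : R -> R -> R)
    (opp : R -> R) :
  (forall x y, x [+] y = [set add x y]) ->
  associative add -> commutative add -> left_id \0 add ->
  left_inverse \0 opp add ->
  associative (@hmul R) -> left_id \1 (@hmul R) -> right_id \1 (@hmul R) ->
  left_distributive (@hmul R) add -> right_distributive (@hmul R) add ->
  (forall x : R, x * \0 = \0) ->
  (\1 : R) <> \0 ->
  (forall x : R, x <> \0 -> exists y, x * y = \1 /\ y * x = \1) ->
  exists K : unitRingType, is_skew_field K /\
    hisomorphic R (hyperstruct_of_ring K).
Proof.
move=> addE addA addC add0 addN mulA mul1x mulx1 mulDl mulDr mulx0 n10 invR.
(* Inversion in a [unitRingType] must fix every non-unit, hence the value [\0] at [\0]. *)
have /choice[inv invP] : forall x : R, exists y,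
    (x <> \0 -> x * y = \1 /\ y * x = \1) /\ (x = \0 -> y = \0).
  move=> x; have [x0|/[dup] x0 /invR[y yP]] := EM (x = \0); first by exists \0.
  by exists y.
pose C : choiceType := HB.pack (hcarrier R) (gen_eqMixin R) (gen_choiceMixin R).
have n10' : (\1 : C) != \0 by apply/eqP.
pose K : nzRingType := HB.pack (hcarrier R) (Choice.on C)
  (GRing.isNzRing.Build C addA addC add0 addN
    mulA mul1x mulx1 mulDl mulDr n10').
pose unit : pred K := fun x => x != 0%R.
have mulVx : {in unit, left_inverse 1%R (inv : K -> K) *%R}.
  by move=> x /eqP x0; have [/(_ x0)[]] := invP x.
have mulxV : {in unit, right_inverse 1%R (inv : K -> K) *%R}.
  by move=> x /eqP x0; have [/(_ x0)[]] := invP x.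
have unitP (x y : K) : (y * x = 1)%R /\ (x * y = 1)%R -> unit x.
  move=> [+ _]; rewrite /unit; apply: contra_eq_neq => ->.
  by rewrite GRing.mulr0 eq_sym GRing.oner_neq0.
have inv_out : {in [predC unit], (inv : K -> K) =1 id}.
  by move=> x /negPn/eqP x0; have [_ /(_ x0) ->] := invP x.
pose L : unitRingType := HB.pack (hcarrier R) (GRing.NzRing.on K)
  (GRing.NzRing_hasMulInverse.Build K mulVx mulxV unitP inv_out).
exists L; split=> //.
apply: (@hisomorphic_inv R (hyperstruct_of_ring L) id) => //.
  by move=> x; exists x.
by move=> x y z; rewrite addE.
Qed.

Section ResidueOfStringent.
Variables (F : skewHyperfield) (strF : stringent F).
Implicit Types a b x y z w t : F.

Definition dominance_order : weak_order F :=
  @WeakOrder F (@dominated F) (@dominated_asym F strF)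
    (fun a b c => @dominated_neg_trans F strF a b c) (@dominated0x F)
    (@dominatedMl F) (@dominatedMr F) (@dominated_hadd F strF).

Notation sim := (wsim dominance_order).

Let nu := weak_order_valuation dominance_order.
Let E x := x = \0 \/ sim x \1.
Let K := residue_hyperstruct nu.

Let residueP x : residue_set nu x <-> E x.
Proof. exact: residue_weak_order. Qed.

Let K_inj (x y : K) : sval x = sval y -> x = y.
Proof. by case: x y => x ? [y ?]; apply: eq_exist. Qed.

Let E_sim x y : E x -> E y -> x <> \0 -> y <> \0 -> sim x y.
Proof.
move=> [//|x1] [//|y1] _ _; exact: wsim_trans x1 (wsim_sym y1).
Qed.

Let E_of_sim x y : E y -> sim x y -> E x.
Proof.
by move=> [->/wsim0->|y1 xy]; [left|right; apply: wsim_trans y1].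
Qed.

Let EN x : E x -> E (hopp x).
Proof.
move=> [->|[x1 x1']]; first by left; exact: hopp0.
right; split=> [/(@dominatedNx F)|/(@dominatedxN F)]; by rewrite hoppK.
Qed.

(** If x dominates z, reversibility puts y in z + -x = {-x}. If z dominates x, it also dominates y,
    as x and y are similar, and then x lies in z + -y = {z}. Both are excluded. *)
Lemma hadd_sim x y z : sim x y -> y <> hopp x -> (x [+] y) z -> sim z x.
Proof.
move=> [xy yx] yNx xyz; split=> [zx|xz].
  have := hadd_rev xyz.
  by rewrite haddC (dominated_hadd strF (dominatedxN zx)).
have [//|/= /(@dominatedNx F) yz] := wlt_neg_trans (w := dominance_order) y xz.
move: xyz; rewrite haddC => /hadd_rev.
rewrite (dominated_hadd strF yz) => /= zx.
by move: xz; rewrite -zx; exact: dominated_irr.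
Qed.

Let haddE x y z : E x -> E y -> y <> hopp x -> (x [+] y) z -> E z.
Proof.
move=> Ex Ey yNx xyz.
have [x0|x0] := EM (x = \0); first by move: xyz; rewrite x0 hadd0x => ->.
have [y0|y0] := EM (y = \0); first by move: xyz; rewrite y0 haddx0 => ->.
exact: E_of_sim Ex (hadd_sim (E_sim Ex Ey x0 y0) yNx xyz).
Qed.

(** Scaling by [hinv x] moves the question to [\1], where the final case split is made. *)
Let haddNE x : x <> \0 -> (x [+] hopp x) x -> (\1 [+] hopp \1 : set F) \1.
Proof.
move=> x0 /(hmulDl (hinv x)).
by rewrite hmulxN hmulVx.
Qed.

Let sim_absorb a b : b <> \0 -> ~ dominated a b -> (b [+] a) b ->
  a = b \/ a = hopp b.
Proof.
move=> b0 ab bab; apply: contrapT => /not_orP[anb anNb].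
exact/ab/hadd_dominated.
Qed.

(** * The Krasner and sign cases *)

Section NonSingleValued.
Hypothesis N1 : (\1 [+] hopp \1 : set F) \1.

Let haddxx x : (x [+] x) x.
Proof.
have := hmulDl x N1; rewrite hmulxN hmulx1.
by rewrite haddC => /hadd_rev; rewrite hoppK.
Qed.

(* The element of [1 [+] x] absorbs both 1 and [x], since [1 [+] 1] contains 1
   and [x [+] x] contains [x]. *)
Lemma residue_units x : E x -> [\/ x = \0, x = \1 | x = hopp \1].
Proof.
move=> Ex; have [x0|x0] := EM (x = \0); first exact: Or31.
have [xn1|xn1] := EM (x = \1); first exact: Or32.
have [xnN|xnN] := EM (x = hopp \1); first exact: Or33.
have x1 : sim x \1 by case: Ex.
have x1N : x <> hopp \1 by [].
have [z xz] := hadd_nonempty \1 x.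
have z1 : sim z \1 := hadd_sim (wsim_sym x1) x1N xz.
have z0 : z <> \0.
  move=> z0; apply: (@hone_neq0 F); apply/(@wsim0 _ dominance_order)/wsim_sym.
  by rewrite -z0.
have [w /(strF x1N)/(_ xz) ->] := haddA (haddxx \1) xz.
rewrite haddC => z1z; have z1E := sim_absorb z0 z1.2 z1z.
have [u /(strF x1N)/(_ xz) ->] := haddA' (haddxx x) xz.
(* Now [\1] and [x] are each [z] or [hopp z], so [x] would be [\1] or [hopp \1]. *)
move=> /(sim_absorb z0 (wsim_trans x1 (wsim_sym z1)).1).
case: z1E => [<-|/(congr1 (@hopp F))]; first by case.
by rewrite hoppK => <-; rewrite hoppK; case.
Qed.

Lemma residue_krasner : hopp \1 = \1 :> F -> hisomorphic K krasner.
Proof.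
move=> N1E; pose g (b : bool) : K := if b then \1 else \0.
have n10 := @hone_neq0 F.
apply: (@hisomorphic_inv K krasner g) => //.
- by move=> [] [] // /(congr1 sval) => // /esym.
- move=> [x Kx]; have [xE|xE|xE] := residue_units ((residueP x).1 Kx).
  + by exists false; apply: eq_exist.
  + by exists true; apply: eq_exist.
  + by exists true; apply: eq_exist; rewrite xE N1E.
- by move=> [] []; apply: eq_exist; rewrite /= ?hmulx1 ?hmul0x ?hmulx0.
(* Only 1 + 1 has content: it contains 1 by [haddxx], and 0 because -1 = 1. *)
move=> [] [] []; rewrite /= ?hadd0x ?haddx0 /=; split=> //.
- by move=> _; apply/hadd_eq0.
- by move=> /esym/n10.
- by move=> /esym/n10.
Qed.

Lemma residue_sign : hopp \1 <> \1 :> F -> hisomorphic K sign_hyperfield.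
Proof.
move=> N1E.
have KN1 : residue_set nu (hopp \1).
  by apply/residueP/EN; right; exact: wsim_refl.
pose g s : K := match s with
  | SZero => \0 | SOne => \1 | SMinusOne => exist _ _ KN1 end.
have n10 := @hone_neq0 F.
have nN0 : hopp \1 <> \0 :> F by move/hopp_eq0.
have g_inj : injective g.
  by move=> [] [] // /(congr1 sval) => // /esym.
(* Here 1 <> -1, so stringency makes 1 + 1 a singleton, and [haddxx] identifies its element. *)
have hadd11 : \1 [+] \1 = [set \1 : F].
  by apply: (hadd_set1 strF) => //; exact/nesym.
have haddNN : hopp \1 [+] hopp \1 = [set hopp \1 : F].
  by apply: (hadd_set1 strF) => //; rewrite hoppK.
(* The set 1 + -1 is stable under negation, so with 1 it also contains -1. *)
have hadd1N s : (\1 [+] hopp \1) (sval (g s)).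
  case: s => //=; first exact/hadd_eq0.
  by move/haddN: N1; rewrite haddNC.
apply: (@hisomorphic_inv K sign_hyperfield g) => //.
- move=> [x Kx]; have [xE|xE|xE] := residue_units ((residueP x).1 Kx).
  + by exists SZero; apply: eq_exist.
  + by exists SOne; apply: eq_exist.
  + by exists SMinusOne; apply: eq_exist.
- move=> [] []; apply: eq_exist;
    by rewrite /= ?hmulxN ?hmulx1 ?hmul1x ?hmul0x ?hmulx0 ?hoppK ?hopp0.
have setE s (t : sign) : [set sval (g s)] (sval (g t)) <-> [set s] t.
  by split=> [gts|-> //]; apply/g_inj/K_inj.
move=> s t u.
rewrite -[X in X <-> _]/((sval (g s) [+] sval (g t)) (sval (g u))).
case: s t => [] [] /=; rewrite ?hadd0x ?haddx0 ?hadd11 ?haddNN;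
  try first [exact: (setE SZero)|exact: (setE SOne)|exact: (setE SMinusOne)].
- by split=> // _; exact: hadd1N.
- by rewrite haddC; split=> // _; exact: hadd1N.
Qed.

End NonSingleValued.

(** * The skew field case *)

Section SingleValued.
Hypothesis N1 : ~ (\1 [+] hopp \1 : set F) \1.

(** A nonzero [z] similar to [x] is not dominated by it, so z = x or z = -x. Either way x lies in x
    + -x, and scaling contradicts [N1]. *)
Let hadd_sub0 x z : E x -> E z -> (x [+] hopp x) z -> z = \0.
Proof.
move=> Ex Ez xz; apply: contrapT => z0.
have x0 : x <> \0 by move=> x0; move: xz; rewrite x0 hopp0 hadd0x.
have [zx _] := E_sim Ez Ex z0 x0.
apply: N1; apply: (haddNE x0).
have [zE|zE] : z = x \/ z = hopp x.
  by apply: contrapT => /not_orP[? ?]; apply: zx.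
- by move: xz; rewrite {1}zE.
- by move/haddN: xz; rewrite haddNC zE hoppK.
Qed.

Let sum_ex (x y : K) : exists z : K, (x [+] y) z.
Proof.
have [yNx|yNx] := EM (sval y = hopp (sval x)).
  (* Other elements of x + -x may lie outside the residue. *)
  by exists hzero; apply/hadd_eq0.
have [z xyz] := hadd_nonempty (sval x) (sval y).
have Ez : residue_set nu z.
  by apply/residueP/(haddE _ _ yNx xyz); apply/residueP/svalP.
by exists (exist _ z Ez).
Qed.

Let sum_uniq x y z w : E x -> E y -> E z -> E w ->
  (x [+] y) z -> (x [+] y) w -> z = w.
Proof.
move=> Ex Ey Ez Ew; have [->|yNx] := EM (y = hopp x); last exact: strF.
by move=> /(hadd_sub0 Ex Ez)-> /(hadd_sub0 Ex Ew)->.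
Qed.

(** By [haddE], only a sum of opposites can leave the residue. What leaves y + -y differs from y and
    -y, which are in the residue, so it is dominated. *)
Let hadd_out y z w : E y -> E z -> (y [+] z) w ->
  ~ E w -> z = hopp y /\ dominated w y.
Proof.
move=> Ey Ez yzw nEw; have [zNy|zNy] := EM (z = hopp y); last first.
  by case: nEw; exact: haddE yzw.
split=> //; split; last by rewrite -zNy.
- move=> y0; apply: nEw; left.
  by move: yzw; rewrite zNy y0 hopp0 hadd0x.
- by move=> wy; apply: nEw; rewrite wy.
- by move=> wNy; apply: nEw; rewrite wNy; exact: EN.
Qed.

(** Most ring identities follow from [K_uniq]: both sides are residue elements of one hypersum.
    Associativity needs more, as an intermediate sum can leave the residue. *)
Lemma residue_skew_field : exists L : unitRingType,
  is_skew_field L /\ hisomorphic K (hyperstruct_of_ring L).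
Proof.
have EK (x : K) : E (sval x) by apply/residueP/svalP.
have K_uniq (x y z w : K) : (x [+] y) z -> (x [+] y) w -> z = w.
  by move=> xyz xyw; apply/K_inj/(sum_uniq _ _ _ _ xyz xyw).
have /choice[add2 add2P] : forall p : K * K, exists z : K, (p.1 [+] p.2) z.
  by move=> p; exact: sum_ex.
pose add (x y : K) := add2 (x, y).
have addP (x y : K) : (x [+] y) (add x y) := add2P (x, y).
have NK (x : K) : residue_set nu (hopp (sval x)) by apply/residueP/EN.
pose opp (x : K) : K := exist _ (hopp (sval x)) (NK x).
have addC : commutative add.
  by move=> x y; apply: K_uniq (addP x y) _; rewrite /= haddC; exact: addP.
have add0 : left_id \0 add.
  by move=> x; apply: K_uniq (addP _ _) _; rewrite /= hadd0x.
have addN : left_inverse \0 opp add.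
  by move=> x; apply: K_uniq (addP _ _) _; rewrite /= haddC; exact/hadd_eq0.
have addA : associative add.
  move=> x y z; have [w yzw xwt] := haddA (addP x y) (addP (add x y) z).
  (* [y [+] z] may leave the residue, but only if [z = -y] and [w] is dominated
     by [y]; then [x] absorbs [w]. *)
  have [Ew|nEw] := EM (E w).
    have Kw : residue_set nu w by apply/residueP.
    have <- : exist _ w Kw = add y z by apply: K_uniq (addP y z); exact: yzw.
    by apply: K_uniq (addP _ _) _; exact: xwt.
  have [zNy wy] := hadd_out (EK y) (EK z) yzw nEw.
  have yz0 : add y z = \0 by apply: K_uniq (addP y z) _; exact/hadd_eq0.
  have y0 : sval y <> \0 by case: wy.
  rewrite yz0 addC add0; apply: K_inj; move: xwt.
  (* If x = 0, then x + w = {w} would put [w] in the residue. Otherwise x is similar to y and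
     dominates [w] as well. *)
  have [x0|x0] := EM (sval x = \0).
    by rewrite x0 hadd0x => /= tw; case: nEw; rewrite -tw; exact: EK.
  have wx : dominated w (sval x).
    by apply: wlt_wsim (wsim_refl _ w) (E_sim (EK y) (EK x) y0 x0) wy.
  by rewrite (dominated_hadd strF wx) => /= ->.
apply: (single_valued_skew_field (add := add) (opp := opp)) => //.
- by move=> x y; apply/seteqP; split=> [z /(K_uniq _ _ _ _ (addP x y))|_ ->].
- by move=> x y z; apply: K_inj; rewrite /= hmulA.
- by move=> x; apply: K_inj; rewrite /= hmul1x.
- by move=> x; apply: K_inj; rewrite /= hmulx1.
- move=> x y z; apply: K_uniq (addP _ _); exact: hmulDr (addP x y).
- move=> x y z; apply: K_uniq (addP _ _); exact: hmulDl (addP y z).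
- by move=> x; apply: K_inj; rewrite /= hmulx0.
- by move=> /(congr1 sval); exact: hone_neq0.
move=> x xn0; have x0 : sval x <> \0 by move=> x0; apply/xn0/K_inj.
(* Multiplying the similarity of 1 and x by the inverse of x shows that this inverse is similar to
   1. *)
have Ex' : residue_set nu (hinv (sval x)).
  apply/residueP; right; have [//|x1] := EK x.
  have := wsimMl (hinv_neq0 x0) (wsim_sym x1).
  by rewrite hmulx1 hmulVx.
exists (exist _ _ Ex'); split; apply: K_inj; rewrite /=.
  exact: hmulxV.
exact: hmulVx.
Qed.

End SingleValued.

End ResidueOfStringent.

Theorem theorem1p2 (F : skewHyperfield) (hF : doubly_distributive F) :
  exists (d : Order.disp_t) (G : orderedGroupType d) (nu : valuation G F),
    [\/ hisomorphic (residue_hyperstruct nu) krasner,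
        hisomorphic (residue_hyperstruct nu) sign_hyperfield |
        exists K : unitRingType, is_skew_field K /\
          hisomorphic (residue_hyperstruct nu) (hyperstruct_of_ring K)].
Proof.
have strF := doubly_distributive_stringent hF.
exists _, _, (weak_order_valuation (dominance_order strF)).
have [N1|N1] := EM ((\1 [+] hopp \1 : set F) \1); last first.
  exact/Or33/residue_skew_field.
have [E1|E1] := EM (hopp \1 = \1 :> F).
  exact/Or31/residue_krasner.
exact/Or32/residue_sign.
Qed.
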